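(* Let $m\in\mathbb{N}$ and let $A_1,\dots,A_m\subseteq\mathbb{N}$ with $\mathbb{N}=\bigcup_{i=1}^m A_i$. Then there exist $j\in[m]$, an additive IP sequence $\langle x_\alpha\rangle_{\alpha\in\mathcal{P}_f(\mathbb{N})}$ and a multiplicative IP sequence $\langle y_\alpha\rangle_{\alpha\in\mathcal{P}_f(\mathbb{N})}$ such that $$\{x_\alpha,\ y_\alpha,\ x_\alpha y_\beta:\ \alpha,\beta\in\mathcal{P}_f(\mathbb{N}),\ \alpha<\beta\}\subseteq A_j.$$
   Context: $\mathbb{N}$ is the set of positive integers and $[m]=\{1,\dots,m\}$. For a nonempty set $S$, $\mathcal{P}_f(S)$ is the set of nonempty finite subsets of $S$. For $\alpha,\beta\in\mathcal{P}_f(\mathbb{N})$, $\alpha<\beta$ means $\max\alpha<\min\beta$. An additive (resp. multiplicative) IP sequence is a family $\langle x_\alpha\rangle_{\alpha\in\mathcal{P}_f(\mathbb{N})}$ of elements of $\mathbb{N}$ such that $x_{\alpha\cup\beta}=x_\alpha+x_\beta$ (resp. $x_{\alpha\cup\beta}=x_\alpha x_\beta$) for all $\alpha,\beta\in\mathcal{P}_f(\mathbb{N})$ with $\alpha\cap\beta=\emptyset$. *)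

(* Defs.v *)
From mathcomp Require Import all_boot finmap.
From mathcomp Require Import boolp classical_sets.

Set Implicit Arguments.
Unset Strict Implicit.
Unset Printing Implicit Defensive.

Local Open Scope classical_set_scope.

Definition posN : set nat := [set n | 0 < n].

Definition Pf (T : choiceType) (S : set T) : set {fset T} :=
  [set alpha | alpha != fset0 /\ [set` alpha] `<=` S].

(* The maximum serves as the default value of the iterated [minn]: it does not
   affect the minimum of a nonempty set. *)
Definition fset_max (alpha : {fset nat}) : nat := \max_(a <- alpha) a.
Definition fset_min (alpha : {fset nat}) : nat :=
  \big[minn/fset_max alpha]_(a <- alpha) a.

Definition fset_before (alpha beta : {fset nat}) : Prop :=
  fset_max alpha < fset_min beta.

(* A family indexed by [Pf posN] is encoded as a total function on
   [{fset nat}] whose values outside [Pf posN] are irrelevant. *)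
Definition IP_sequence (op : nat -> nat -> nat) (x : {fset nat} -> nat) : Prop :=
  (forall alpha, Pf posN alpha -> posN (x alpha)) /\
  (forall alpha beta, Pf posN alpha -> Pf posN beta ->
     (alpha `&` beta)%fset = fset0 ->
     x (alpha `|` beta)%fset = op (x alpha) (x beta)).

Definition additive_IP (x : {fset nat} -> nat) : Prop := IP_sequence addn x.
Definition multiplicative_IP (y : {fset nat} -> nat) : Prop := IP_sequence muln y.

Lemma fset_beforeP (alpha beta : {fset nat}) :
  alpha != fset0 -> beta != fset0 ->
  fset_before alpha beta <->
  (forall a b, a \in alpha -> b \in beta -> a < b).
Proof.
move=> /fset0Pn[a0 a0A] /fset0Pn[b0 b0B]; rewrite /fset_before.
have maxP a : a \in alpha -> a <= fset_max alpha.
  by move=> aA; rewrite /fset_max (big_rem a) //= leq_maxl.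
have minP (b : nat) (s : seq nat) k : b \in s -> \big[minn/k]_(c <- s) c <= b.
  elim: s => // c s IH; rewrite inE big_cons => /orP[/eqP->|/IH h].
    exact: geq_minl.
  exact: leq_trans (geq_minr _ _) h.
split=> [lt_ab a b aA bB|H].
  exact: leq_ltn_trans (maxP a aA) (leq_trans lt_ab (minP b _ _ bB)).
have mx b : b \in beta -> fset_max alpha < b.
  move=> bB; rewrite /fset_max big_seq.
  by elim/big_ind: _ => [|u v|a aA]; [exact: leq_ltn_trans (H _ _ a0A bB)
    | rewrite gtn_max => -> ->| exact: H].
rewrite /fset_min big_seq; elim/big_ind: _ => [|u v|b bB]; last exact: mx.
  apply: leq_trans (mx _ b0B) _.
  by rewrite /fset_max (big_rem b0) //= leq_maxl.
by rewrite leq_min => -> ->.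
Qed.

(* Main.v *)
Require Import Defs.
From mathcomp Require Import all_boot finmap.
From mathcomp Require Import boolp classical_sets filter.

Set Implicit Arguments.
Unset Strict Implicit.
Unset Printing Implicit Defensive.

Local Open Scope classical_set_scope.

(** The positive integers are finitely covered, so every ultrafilter [q]
    containing their set has some [A j] as a member; the point is to choose [q]
    so that this membership alone produces both sequences and all mixed
    products.

    Write [F * G] for the product of filters extending a binary operation:
    [A] is in [F * G] when, for [F]-many [x], [op x y] is in [A] for [G]-many
    [y]. Call [F] subidempotent when [F] is included in [F * F]; for an
    ultrafilter this means [F = F * F]. Everything rests on three facts.

    - In any semigroup a subidempotent proper filter extends to an idempotent
      ultrafilter ([idempotent_ultrafilter_exists]). The usual topological
      argument on the compact semigroup of ultrafilters is replaced here by
      Zorn's lemma on filters: a maximal subidempotent filter is already an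
      ultrafilter ([maximal_subidempotent_ultra]).

    - The intersection [IPstar] of all additively idempotent ultrafilters that
      contain [posN] is multiplicatively subidempotent
      ([IPstar_subidempotent]), because the dilation of an additive idempotent
      by a positive integer is an additive idempotent, by distributivity. So
      there is a multiplicative idempotent [q] containing [IPstar], and every
      member of [q] is a member of some additive idempotent
      ([additive_idempotent_of_IPstar]).

    - Given sets [D n] in a subidempotent proper filter, there is a sequence
      whose finite products with all indices at least [n] lie in [D n]
      ([subidempotent_products], the Galvin-Glazer construction).

    Now let [A j] be in [q]. As [q] is multiplicatively idempotent, the set [B]
    of those [x] in [A j] for which [x * y] is in [A j] for [q]-many [y] is in
    [q], hence in some additive idempotent [p]. The third fact for [p] and the
    constant family [B] gives the additive IP sequence inside [B]. With that
    sequence fixed, the set [D n] of those [y] in [A j] for which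
    [x_alpha * y] is in [A j] for all the finitely many nonempty [alpha]
    below [n] belongs to [q], and the third fact for [q] gives the
    multiplicative one. *)

(** * Ultrafilters *)

Lemma ultra_fmap (T U : Type) (f : T -> U) (p : set_system T) :
  UltraFilter p -> UltraFilter (f @ p).
Proof.
move=> pU; split=> [|G GF fpG]; first exact: fmap_proper_filter.
rewrite eqEsubset; split=> // A GA.
have [//|pnA] := in_ultra_setVsetC (f @^-1` A) pU.
case: (filter_not_empty G); rewrite -(setICr A); apply: filterI => //.
exact: fpG.
Qed.

Lemma ultra_finite_cover (T : Type) (I : finType) (A : I -> set T)
    (p : set_system T) :
  UltraFilter p -> p (\bigcup_(i in [set: I]) A i) -> exists i, p (A i).
Proof.
move=> pU pUA; apply: contrapT => /forallNP npA.
have pnA : p (\bigcap_(i in [set` [fset i in enum I]%fset]) ~` A i).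
  apply: filter_bigI => i _.
  by have [/npA|] := in_ultra_setVsetC (A i) pU.
have [x [[i _ Aix]]] := filter_ex (filterI pUA pnA).
by move=> /(_ i); apply => //=; rewrite inE mem_enum.
Qed.

(** * Idempotent ultrafilters *)

Definition filter_mul (T : Type) (op : T -> T -> T) (F G : set_system T) :
    set_system T :=
  [set A | F [set x | G [set y | A (op x y)]]].

Definition subidempotent (T : Type) (op : T -> T -> T) (F : set_system T) :=
  F `<=` filter_mul op F F.

Lemma filter_mul_proper (T : Type) (op : T -> T -> T) (F G : set_system T) :
  ProperFilter F -> ProperFilter G -> ProperFilter (filter_mul op F G).
Proof.
move=> FF GF; split; [|split].
- by move=> /(@filter_ex _ F _)[x] /(@filter_ex _ G _)[y].
- by apply: (@filterS _ F _ _ _ _ filterT) => x _; exact: filterT.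
- move=> A B FA FB; apply: (@filterS2 _ F) FA FB => x; exact: filterI.
- by move=> A B sAB; apply: (@filterS _ F) => x; apply: filterS => y /sAB.
Qed.

Definition maximal_subidempotent (T : Type) (op : T -> T -> T)
    (F : set_system T) :=
  [/\ ProperFilter F, subidempotent op F &
    forall G, ProperFilter G -> subidempotent op G -> F `<=` G -> G `<=` F].

(** Subidempotence passes to unions of chains, so Zorn's lemma applies. *)
Lemma maximal_subidempotent_exists (T : Type) (op : T -> T -> T)
    (F : set_system T) :
  ProperFilter F -> subidempotent op F ->
  exists2 G, F `<=` G & maximal_subidempotent op G.
Proof.
move=> FF Fid.
(* [Zorn_bigcup] asks for a bound of the empty chain as well, whose union is
   not a filter: [P] therefore accepts the empty set system. *)
pose P (G : set_system T) :=
  G !=set0 -> [/\ ProperFilter G, subidempotent op G & F `<=` G].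
have [|M [PM Mmax]] := @Zorn_bigcup _ P.
  move=> C CP Ctot [A0 [G0 CG0 G0A0]].
  have PC G A : C G -> G A ->
      [/\ ProperFilter G, subidempotent op G & F `<=` G].
    by move=> CG GA; apply: (CP G CG); exists A.
  have [G0F G0id FG0] := PC _ _ CG0 G0A0.
  split; first split; [|split|..].
  - move=> [G CG /[dup] Gs /filter_not_empty].
    by apply; have [] := PC _ _ CG Gs.
  - by exists G0 => //; exact: filterT.
  - move=> A B [G CG GA] [H CH HB].
    have [GF _ _] := PC _ _ CG GA; have [HF _ _] := PC _ _ CH HB.
    have [GH|HG] := Ctot _ _ CG CH.
      by exists H => //; apply: filterI => //; exact: GH.
    by exists G => //; apply: filterI => //; exact: HG.
  - move=> A B sAB [G CG GA]; exists G => //.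
    by have [GF _ _] := PC _ _ CG GA; exact: filterS sAB GA.
  - move=> A [G CG GA]; have [GF Gid _] := PC _ _ CG GA.
    by exists G => //; apply: (@filterS _ G) (Gid _ GA) => x Gx; exists G.
  - by move=> A FA; exists G0 => //; exact: FG0.
have M0 : M !=set0.
  apply: contrapT => M0; apply: (Mmax F); last by move=> _; split.
  split; first by move=> A MA; case: M0; exists A.
  by move=> /(_ setT filterT) MT; apply: M0; exists setT.
have [MF Mid FM] := PM M0.
exists M => //; split=> // G GF Gid MG A GA; apply: contrapT => MA.
apply: (Mmax G); first by split=> // /(_ A GA).
by move=> _; split=> //; exact: subset_trans MG.
Qed.

(** Let [p] be an ultrafilter extending a maximal [F]. Maximality is used twice.
    The product [F * p] contains [F] and is subidempotent, so it equals [F].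
    Hence for [A] in [p] the set [S A] of those [x] with [op x y] in [A] for
    [p]-many [y] meets every member of [F], and the filter generated by [F] and
    the sets [S A] is proper and subidempotent, so it also equals [F]. Then
    [S A] is in [F], that is [A] is in [F * p = F], for every [A] in [p]. *)
Lemma maximal_subidempotent_ultra (T : Type) (op : T -> T -> T)
    (F : set_system T) :
  associative op -> maximal_subidempotent op F -> UltraFilter F.
Proof.
move=> opA [FF Fid Fmax].
have [p [pU Fp]] := ultraFilterLemma FF.
suff pF : p `<=` F by have <- : p = F by rewrite eqEsubset.
have Fp_sub : filter_mul op F p `<=` F.
  have Fsub : F `<=` filter_mul op F p.
    by move=> A /Fid; apply: (@filterS _ F) => x; exact: Fp.
  apply: (Fmax _ _ _ Fsub); first exact: filter_mul_proper.
  move=> A /Fid FA; apply: Fsub; apply: (@filterS _ F) FA => x /=.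
  by apply: (@filterS _ F) => y; apply: (@filterS _ p) => z /=; rewrite opA.
pose S A := [set x | p [set y | A (op x y)]].
have SF A B : p A -> F B -> B `&` S A !=set0.
  move=> pA FB; apply: contrapT => BA.
  suff /Fp pnA : F (~` A).
    by apply: (filter_not_empty p); rewrite -(setICr A); exact: filterI.
  apply: Fp_sub; apply: filterS FB => x Bx /=.
  have [pS|//] := in_ultra_setVsetC [set y | A (op x y)] pU.
  by case: BA; exists x.
pose G := filter_from [set BA : set T * set T | F BA.1 /\ p BA.2]
  (fun BA => BA.1 `&` S BA.2).
have GF : ProperFilter G.
  apply: filter_from_proper => [|[B A] [FB pA]]; last exact: SF.
  apply: filter_from_filter; first by exists (setT, setT); split;
    exact: filterT.
  move=> [B A] [B' A'] [/= FB pA] [/= FB' pA'].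
  exists (B `&` B', A `&` A'); first by split; exact: filterI.
  move=> x [[Bx B'x]]; rewrite /S /= => pAA'.
  by do 2 split=> //; apply: filterS pAA' => y [].
have FG : F `<=` G.
  by move=> B FB; exists (B, setT) => [|x []//]; split=> //; exact: filterT.
have GsubF : G `<=` F.
  apply: (Fmax G) FG => // C [[B A] [/= FB pA] BAC].
  exists ([set x | F [set y | B (op x y)]], A); first by split=> //; exact: Fid.
  move=> x [/= FBx pAx].
  exists ([set y | B (op x y)], [set y | A (op x y)]) => //.
  move=> y [/= Bxy pAxy]; apply: BAC; split=> //; rewrite /S /=.
  by apply: filterS pAxy => z /=; rewrite opA.
move=> A pA; apply/Fp_sub/GsubF.
by exists (setT, A) => [|x []//]; split=> //; exact: filterT.
Qed.

Lemma idempotent_ultrafilter_exists (T : Type) (op : T -> T -> T)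
    (F : set_system T) :
  associative op -> ProperFilter F -> subidempotent op F ->
  exists p, [/\ UltraFilter p, subidempotent op p & F `<=` p].
Proof.
move=> opA FF Fid.
have [p Fp pmax] := maximal_subidempotent_exists FF Fid.
by exists p; split=> //; [exact: maximal_subidempotent_ultra pmax|case: pmax].
Qed.

(** Build decreasing sets [E n] in [F] and points [s n] in [E n] so that
    [E n.+1] lies in [D n.+1] and in the set of [y] with [op (s n) y] in [E n];
    such points exist by subidempotence. A product over indices at least [n] is
    in [E n], by induction on the number of factors: with least index [a], the
    other factors have their product in [E a.+1], and multiplying it by [s a]
    leads into [E a]. *)
Lemma subidempotent_products (T : Type) (idx : T) (op : Monoid.com_law idx)
    (F : set_system T) (D : nat -> set T) :
  ProperFilter F -> subidempotent op F -> (forall n, F (D n)) ->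
  exists s : nat -> T, forall (n : nat) (alpha : {fset nat}),
    alpha != fset0 -> (forall a, a \in alpha -> n <= a) ->
    D n (\big[op/idx]_(a <- alpha) s a).
Proof.
move=> FF Fid FD.
have pick (E : {E | F E}) :
    {x | sval E x /\ F [set y | sval E (op x y)]}.
  case: E => E FE /=; apply: cid.
  exact: (filter_ex (filterI FE (Fid _ FE))).
have FI : setI_closed F by exact: filterI.
pose next n (E : {E | F E}) : {E | F E} :=
  exist (fun E => F E) _
    (FI _ _ (FI _ _ (svalP E) (svalP (pick E)).2) (FD n.+1)).
pose E := fix E n :=
  if n is m.+1 then next m (E m) else exist (fun E => F E) _ (FD 0).
pose s n := sval (pick (E n)).
exists s.
have sE n : sval (E n) (s n) by exact: (svalP (pick (E n))).1.
have ES n x : sval (E n.+1) x -> sval (E n) x /\ sval (E n) (op (s n) x).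
  by move=> [[]].
have Emono n m x : n <= m -> sval (E m) x -> sval (E n) x.
  elim: m => [|m IH]; first by rewrite leqn0 => /eqP->.
  rewrite leq_eqVlt ltnS => /predU1P[-> //|/IH sub /ES[Ex _]]; exact: sub.
have ED n x : sval (E n) x -> D n x by case: n => [|n] //= [].
move=> n alpha alpha0 n_alpha; apply: ED; move: alpha alpha0 n n_alpha.
suff H k (alpha : {fset nat}) : #|` alpha| = k.+1 ->
    forall n, (forall a, a \in alpha -> n <= a) ->
    sval (E n) (\big[op/idx]_(a <- alpha) s a).
  move=> alpha; rewrite -cardfs_gt0 => alpha0.
  by apply: (H #|` alpha|.-1); rewrite prednK.
elim: k alpha => [|k IH] alpha.
  move=> /eqP/cardfs1P[a ->] n na; rewrite big_seq_fset1.
  by apply: Emono (sE a); apply: na; rewrite inE.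
move=> alphak n na.
have [a0 a0_alpha] : exists a, a \in alpha.
  by apply/fset0Pn; rewrite -cardfs_gt0 alphak.
have ex_alpha : exists a, a \in alpha by exists a0.
have [a a_alpha a_min] := ex_minnP ex_alpha.
apply: (Emono _ a); first exact: na.
rewrite (big_fsetD1 a) //=.
apply: (proj2 (ES _ _ _)); apply: IH.
  by move: alphak; rewrite (cardfsD1 a) a_alpha => -[].
move=> b; rewrite !inE => /andP[ba /a_min]; rewrite leq_eqVlt.
case/predU1P=> [ab|//]; by rewrite ab eqxx in ba.
Qed.

(** * Additive idempotents and dilations *)

Definition additive_idempotent (p : set_system nat) :=
  [/\ UltraFilter p, subidempotent addn p & p posN].

Lemma additive_idempotent_exists : exists p, additive_idempotent p.
Proof.
have posF : ProperFilter (globally posN).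
  exact: (@globally_properfilter _ _ 1).
have [|p [pU pid pos_p]] := idempotent_ultrafilter_exists addnA posF.
  move=> A Apos x x0 y _; apply: Apos; exact: ltn_addr.
by exists p; split=> //; exact: pos_p.
Qed.

Lemma dilation_idempotent (p : set_system nat) (x : nat) :
  posN x -> additive_idempotent p -> additive_idempotent (muln x @ p).
Proof.
move=> x0 [pU pid ppos]; split; first exact: ultra_fmap.
  move=> A /pid; apply: (@filterS _ p) => a; apply: (@filterS _ p) => b /=.
  by rewrite mulnDr.
rewrite fmapE; apply: filterS ppos => y y0.
by rewrite /posN /= muln_gt0 x0.
Qed.

(** These are the IP* sets of combinatorial number theory, those that meet the
    set of finite sums of every sequence of positive integers. *)
Definition IPstar : set_system nat :=
  [set A | forall p, additive_idempotent p -> p A].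

Lemma IPstar_proper : ProperFilter IPstar.
Proof.
split; [|split].
- have [p pid] := additive_idempotent_exists.
  by move=> /(_ p pid); case: pid => pU _ _; exact: filter_not_empty.
- by move=> p [pU _ _]; exact: filterT.
- move=> A B IA IB p pid; case: (pid) => pU _ _.
  by apply: filterI; [exact: IA|exact: IB].
- by move=> A B sAB IA p pid; case: (pid) => pU _ _; exact: filterS (IA p pid).
Qed.

(** For [x > 0], the set of [y] with [x * y] in [A] is again in [IPstar], since
    dilating an additive idempotent by [x] gives another one. *)
Lemma IPstar_subidempotent : subidempotent muln IPstar.
Proof.
move=> A IA p [pU _ ppos]; apply: filterS ppos => x x0 r rid.
exact: (IA _ (dilation_idempotent x0 rid)).
Qed.

(** The additive idempotents containing [posN] are dense in the closed set of
    ultrafilters containing [IPstar]: if [~` B] were a member of all of them,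
    it would be in [IPstar], hence in [q]. *)
Lemma additive_idempotent_of_IPstar (q : set_system nat) (B : set nat) :
  UltraFilter q -> IPstar `<=` q -> q B ->
  exists2 p, additive_idempotent p & p B.
Proof.
move=> qU Iq qB; apply: contrapT => npB; apply: (filter_not_empty q).
rewrite -(setICr B); apply: filterI => //; apply: Iq => p pid.
case: (pid) => pU _ _.
by have [pB|//] := in_ultra_setVsetC B pU; case: npB; exists p.
Qed.

(** * IP sequences *)

Lemma big_fset_IP_sequence (idx : nat) (op : Monoid.com_law idx)
    (s : nat -> nat) :
  (forall alpha, Pf posN alpha -> posN (\big[op/idx]_(a <- alpha) s a)) ->
  IP_sequence op (fun alpha => \big[op/idx]_(a <- alpha) s a).
Proof.
move=> spos; split=> // alpha beta _ _ dis.
rewrite -big_cat; apply: perm_big; apply: uniq_perm => //.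
  rewrite cat_uniq !fset_uniq andbT /=; apply/hasPn => b b_beta.
  apply/negP => b_alpha.
  by have := in_fset0 b; rewrite -dis inE b_alpha b_beta.
by move=> a; rewrite mem_cat !inE.
Qed.

Theorem theoremC (m : nat) (m_gt0 : 0 < m) (A : 'I_m -> set nat)
    (A_sub : forall i : 'I_m, A i `<=` posN)
    (A_cover : posN = \bigcup_(i in [set: 'I_m]) A i) :
  exists (j : 'I_m) (x y : {fset nat} -> nat),
    [/\ additive_IP x, multiplicative_IP y &
      [set z | exists alpha beta : {fset nat},
         [/\ Pf posN alpha, Pf posN beta, fset_before alpha beta &
             [\/ z = x alpha, z = y alpha | z = x alpha * y beta]]]
        `<=` A j].
Proof.
have [q [qU qid Iq]] :=
  idempotent_ultrafilter_exists mulnA IPstar_proper IPstar_subidempotent.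
have [j qAj] : exists j, q (A j).
  by apply: ultra_finite_cover; rewrite -A_cover; apply: Iq => p [].
pose B := A j `&` [set x | q [set y | A j (x * y)]].
have [p [pU pid _] pB] : exists2 p, additive_idempotent p & p B.
  apply: additive_idempotent_of_IPstar => //.
  exact: (@filterI _ q) (qid _ qAj).
have [s sB] := @subidempotent_products _ _ addn p (fun=> B) _ pid (fun=> pB).
pose x (alpha : {fset nat}) := \sum_(a <- alpha) s a.
have xB alpha : alpha != fset0 -> B (x alpha).
  by move=> alpha0; apply: (sB 0).
(* The meet runs over the finitely many subsets of [0, n), so it stays in q. *)
pose D n := A j `&`
  \bigcap_(alpha in [set` fpowerset [fset k in iota 0 n]%fset])
  [set y | alpha != fset0 -> A j (x alpha * y)].
have qD n : q (D n).
  apply: filterI => //; apply: filter_bigI => alpha _.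
  have [->|alpha0] := eqVneq alpha fset0; first by apply: filterS filterT.
  by apply: (@filterS _ q) (proj2 (xB _ alpha0)) => z Az _; exact: Az.
have [t tD] := @subidempotent_products _ _ muln q D _ qid qD.
pose y (beta : {fset nat}) := \prod_(b <- beta) t b.
have yA beta : beta != fset0 -> A j (y beta).
  by move=> beta0; have [] := tD 0 beta beta0.
exists j, x, y; split.
- apply: big_fset_IP_sequence => alpha [alpha0 _].
  by apply: (A_sub j); case: (xB _ alpha0).
- by apply: big_fset_IP_sequence => alpha [alpha0 _]; apply/(A_sub j)/yA.
move=> _ [alpha [beta [[alpha0 _] [beta0 _] ab [->|->|->]]]].
- by case: (xB _ alpha0).
- exact: yA.
have {}ab := (fset_beforeP alpha0 beta0).1 ab.
have max_beta b : b \in beta -> fset_max alpha < b.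
  move=> b_beta; have [a0 a0_alpha] := fset0Pn _ alpha0.
  have b0 : 0 < b by exact: leq_ltn_trans (ab _ _ a0_alpha b_beta).
  rewrite -(prednK b0) ltnS; apply/bigmax_leqP_seq => a a_alpha _.
  by rewrite -ltnS prednK //; exact: ab.
have [_ /(_ alpha)] := tD (fset_max alpha).+1 beta beta0 max_beta.
have fset_max_ge a : a \in alpha -> a <= fset_max alpha.
  by move=> a_alpha; rewrite /fset_max (big_rem a) //= leq_maxl.
apply => //=; rewrite fpowersetE; apply/fsubsetP => a /fset_max_ge a_max.
by rewrite !inE mem_iota /= ltnS a_max andbT lt0n orbN.
Qed.
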